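(* Let $A$ generate the semigroup $(T(t))_{t\ge0}$ of negative growth bound on the Banach space $X_0$, in the sense specified in the context. Then there is an extension $(T_{-1}(t))_{t\ge0}$ of the semigroup $(T(t))_{t\ge0}$ to a semigroup of bounded linear operators on the extrapolated space $X_{-1}$, whose generator (in the same sense, with respect to a norming subspace of $X_{-1}'$) is $A_{-1}$.
   Context: Semigroups and generators. Let $Z$ be a Banach space and $Y\subseteq Z'$ a norming subspace: $\|z\|=\sup_{y\in Y,\|y\|\le1}|\langle z,y\rangle|$ for $z\in Z$. A semigroup $T:[0,\infty)\to\mathscr{L}(Z)$ ($T(0)=I$, $T(t+s)=T(t)T(s)$) of contractions, not necessarily strongly continuous, has generator $A:D(A)\to Z$ (with respect to $Y$) if $[0,\infty)\subseteq\rho(A)$, and for each $\lambda\ge0$, $x\in Z$, $y\in Y$ one has $\langle R(\lambda,A)x,y\rangle=\int_0^\infty e^{-\lambda s}\langle T(s)x,y\rangle\,ds$, and moreover $T(t)$ commutes with $A^{-1}$ for each $t\ge0$. In the claim this is assumed for $Z=X_0$, some norming $Y\subseteq X_0'$, $(T(t))_{t\geq 0}$ and $A$. Negative growth bound means $\|T(t)\|\le Me^{-\varepsilon t}$ for all $t\ge0$, for some $M\ge1$, $\varepsilon>0$. Extrapolation space. Let $\underline{X}_0:=\overline{D(A)}$; the part $\underline A$ of $A$ in $\underline X_0$ is densely defined in $\underline{X}_0$. $\underline{X}_{-1}$ is the completion of $X_0$ for the norm $\|x\|_{\underline{X}_{-1}}:=\|A^{-1}x\|$, and $\underline{A}_{-1}:\underline{X}_0\to\underline{X}_{-1}$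 is the unique continuous extension of $A:(D(A),\|\cdot\|)\to(X_0,\|\cdot\|_{\underline{X}_{-1}})$, an isometric isomorphism. $\underline{X}_{-2}$ is the completion of $\underline{X}_{-1}$ for the norm $\|\underline{A}_{-1}^{-1}x\|_{\underline{X}_{-1}}$, and $\underline{A}_{-2}:\underline{X}_{-1}\to\underline{X}_{-2}$ is the unique continuous extension of $\underline{A}_{-1}$, an isometric isomorphism. Thus $\underline{X}_0\subseteq X_0\subseteq\underline{X}_{-1}\subseteq\underline{X}_{-2}$. $X_{-1}:=\underline{A}_{-2}(X_0)$ with norm $\|x\|_{X_{-1}}:=\|\underline{A}_{-2}^{-1}x\|$ (one has $X_0\subseteq X_{-1}$), and $A_{-1}$ is the restriction of $\underline{A}_{-2}$ to $X_0$, considered as an operator on $X_{-1}$ with domain $X_0$. *)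

(* Defs.v *)
From HB Require Import structures.
From mathcomp Require Import all_boot all_order all_algebra.
From mathcomp Require Import complex.
From mathcomp Require Import all_classical all_reals all_analysis.

Set Implicit Arguments.
Unset Strict Implicit.
Unset Printing Implicit Defensive.

Import Order.TTheory GRing.Theory Num.Theory.
Import numFieldNormedType.Exports.

Local Open Scope classical_set_scope.
Local Open Scope ring_scope.

(* Banach spaces are over the reals or over the complex numbers; the two cases
   are treated uniformly. *)
Inductive scalar_kind := RealScalars | ComplexScalars.

Definition scalars (R : realType) (k : scalar_kind) : numFieldType :=
  match k with RealScalars => R | ComplexScalars => R[i] end.

Definition scalar_re {R : realType} {k : scalar_kind} : scalars R k -> R :=
  match k return scalars R k -> R with
  | RealScalars => id
  | ComplexScalars => @complex.Re R
  end.

Definition scalar_im {R : realType} {k : scalar_kind} : scalars R k -> R :=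
  match k return scalars R k -> R with
  | RealScalars => fun=> 0
  | ComplexScalars => @complex.Im R
  end.

Definition of_real {R : realType} (k : scalar_kind) (r : R) : scalars R k :=
  match k return scalars R k with
  | RealScalars => r
  | ComplexScalars => (r%:C)%C
  end.

(* Lebesgue integral over [0, +oo) of a scalar-valued function, taken
   componentwise; measurability is Lebesgue (not only Borel) measurability. *)
Definition has_integral {R : realType} {k : scalar_kind}
    (f : R -> scalars R k) (l : scalars R k) : Prop :=
  let mu := @completed_lebesgue_measure R in
  let D : set R := [set s : R | 0 <= s] in
  [/\ mu.-integrable D (fun s => (scalar_re (f s))%:E),
      mu.-integrable D (fun s => (scalar_im (f s))%:E),
      scalar_re l = (\int[mu]_(s in D) scalar_re (f s))%R &
      scalar_im l = (\int[mu]_(s in D) scalar_im (f s))%R].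

Section generators.
Context {R : realType} {k : scalar_kind}.
Local Notation K := (scalars R k).

(* Only meaningful for bounded [f]: otherwise [sup] returns its default. *)
Definition opnorm {V W : normedModType K} (f : V -> W) : R :=
  sup [set scalar_re `|f x| | x in [set x : V | `|x| <= 1]].

Record partial_op (Z : lmodType K) :=
  PartialOp { dom : set Z ; op :> Z -> Z }.

Definition linear_op {Z : lmodType K} (A : partial_op Z) : Prop :=
  dom A 0 /\
  forall (a : K) (x y : Z), dom A x -> dom A y ->
    dom A (a *: x + y) /\ A (a *: x + y) = a *: A x + A y.

Definition inverse_op {Z : lmodType K} (A : partial_op Z) : Z -> Z :=
  'pinv_(fun=> 0) (dom A) A.

Section Banach.
Variable Z : completeNormedModType K.

Definition resolvent (A : partial_op Z) (lambda : K) : Z -> Z :=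
  'pinv_(fun=> 0) (dom A) (fun x => lambda *: x - A x).

Definition resolvent_set (A : partial_op Z) : set K :=
  [set lambda | set_bij (dom A) setT (fun x => lambda *: x - A x) /\
                continuous (resolvent A lambda)].

Definition dual_subspace (Y : set (Z -> K)) : Prop :=
  [/\ forall y, Y y -> scalar y /\ continuous y,
      Y (fun=> 0) &
      forall (a : K) y1 y2, Y y1 -> Y y2 -> Y (fun z => a * y1 z + y2 z)].

Definition norming (Y : set (Z -> K)) : Prop :=
  forall z : Z, scalar_re `|z| =
    sup [set scalar_re `|y z| | y in [set y | Y y /\ opnorm (y : Z -> K^o) <= 1]].

(* The values [T t] for [t < 0] are irrelevant. *)
Definition semigroup (T : R -> Z -> Z) : Prop :=
  [/\ forall t, 0 <= t -> linear (T t) /\ continuous (T t),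
      T 0 = id &
      forall t s, 0 <= t -> 0 <= s -> T (t + s) = T t \o T s].

Record generator (Y : set (Z -> K)) (T : R -> Z -> Z) (A : partial_op Z)
    : Prop := {
  generator_subspace : dual_subspace Y ;
  generator_norming : norming Y ;
  generator_semigroup : semigroup T ;
  generator_contraction : forall t, 0 <= t -> opnorm (T t) <= 1 ;
  generator_linear : linear_op A ;
  generator_resolvent_set :
    forall lambda : R, 0 <= lambda -> resolvent_set A (of_real k lambda) ;
  generator_laplace :
    forall (lambda : R) (x : Z) (y : Z -> K), 0 <= lambda -> Y y ->
      has_integral (fun s => of_real k (expR (- (lambda * s))) * y (T s x))
                   (y (resolvent A (of_real k lambda) x)) ;
  generator_comm :
    forall t, 0 <= t -> T t \o inverse_op A = inverse_op A \o T t }.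

Definition negative_growth_bound (T : R -> Z -> Z) : Prop :=
  exists M eps : R, [/\ 1 <= M, 0 < eps &
    forall t, 0 <= t -> opnorm (T t) <= M * expR (- (eps * t))].

End Banach.

(* [j] exhibits [W] as the completion of [V] for the norm [N], which need not be
   the norm of [V]. *)
Definition is_completion {V : lmodType K} {W : completeNormedModType K}
    (N : V -> K) (j : {linear V -> W}) : Prop :=
  [/\ injective j, dense (range j) & forall x, `|j x| = N x].

(* The prefix u stands for an underline: uXm1, uXm2, uAm1, uAm2 are the
   underlined X_{-1}, X_{-2}, A_{-1}, A_{-2}, and the underlined X_0 is
   [closure (dom A)], the only place where the values of [uAm1] matter. The
   completions are determined up to isometric isomorphism only, so they are data
   here, together with the embeddings [emb1] and [emb2]. *)
Record extrapolation (X0 : completeNormedModType K) (A : partial_op X0) := {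
  uXm1 : completeNormedModType K ;
  emb1 : {linear X0 -> uXm1} ;
  emb1_completion : is_completion (fun x => `|inverse_op A x|) emb1 ;
  uAm1 : X0 -> uXm1 ;
  uAm1_extends : forall x, dom A x -> uAm1 x = emb1 (A x) ;
  uAm1_continuous : {within closure (dom A), continuous uAm1} ;
  uAm1_linear : forall (a : K) x y, closure (dom A) x -> closure (dom A) y ->
    uAm1 (a *: x + y) = a *: uAm1 x + uAm1 y ;
  uAm1_isometric : forall x, closure (dom A) x -> `|uAm1 x| = `|x| ;
  uAm1_onto : uAm1 @` closure (dom A) = setT ;
  uXm2 : completeNormedModType K ;
  emb2 : {linear uXm1 -> uXm2} ;
  emb2_completion : is_completion
    (fun x => `|emb1 ('pinv_(fun=> 0) (closure (dom A)) uAm1 x)|) emb2 ;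
  uAm2 : {linear uXm1 -> uXm2} ;
  uAm2_extends : forall x, closure (dom A) x -> uAm2 (emb1 x) = emb2 (uAm1 x) ;
  uAm2_continuous : continuous uAm2 ;
  uAm2_isometric : forall x, `|uAm2 x| = `|x| ;
  uAm2_onto : range uAm2 = setT }.

Section extrapolated_space.
Variables (X0 : completeNormedModType K) (A : partial_op X0).
Variable E : extrapolation A.

Let U : {linear X0 -> uXm2 E} := uAm2 E \o emb1 E.

Definition in_Xm1 : {pred uXm2 E} := fun x => `[< range U x >].

Lemma in_Xm1P x : reflect (exists z, U z = x) (x \in in_Xm1).
Proof.
by apply: (iffP (asboolP _)) => [[z _ <-]|[z <-]]; exists z.
Qed.

Lemma in_Xm1_submod_closed : submod_closed in_Xm1.
Proof.
split; first by apply/in_Xm1P; exists 0; rewrite linear0.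
move=> a _ _ /in_Xm1P[x <-] /in_Xm1P[y <-].
by apply/in_Xm1P; exists (a *: x + y); rewrite linearP.
Qed.

HB.instance Definition _ :=
  GRing.isSubmodClosed.Build K (uXm2 E) in_Xm1 in_Xm1_submod_closed.

(* X_{-1} = A_{-2}(X_0). *)
Record Xm1 : Type := InXm1 { Xm1_val : uXm2 E ; Xm1_valP : Xm1_val \in in_Xm1 }.

HB.instance Definition _ := [isSub for Xm1_val].
HB.instance Definition _ := [Choice of Xm1 by <:].
HB.instance Definition _ := [SubChoice_isSubLmodule of Xm1 by <:].

Lemma U_inj : injective U.
Proof.
move=> x y /= /eqP; rewrite -subr_eq0 -linearB -normr_eq0 uAm2_isometric.
rewrite normr_eq0 subr_eq0 => /eqP.
by have [inj _ _] := emb1_completion E; apply: inj.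
Qed.

Definition Am2_inv (x : Xm1) : X0 :=
  'pinv_(fun=> 0) setT (uAm2 E \o emb1 E) (Xm1_val x).

Definition Am2_Xm1 (z : X0) : Xm1 :=
  InXm1 (introT (in_Xm1P (uAm2 E (emb1 E z))) (ex_intro _ z erefl)).

Lemma Am2_invK : cancel Am2_inv Am2_Xm1.
Proof.
move=> x; apply: val_inj => /=.
have /in_Xm1P[z zx] := Xm1_valP x.
by rewrite [LHS](@pinvK _ _ (fun=> 0) setT U)// inE -zx; exists z.
Qed.

Lemma Am2_Xm1K : cancel Am2_Xm1 Am2_inv.
Proof.
by move=> z; apply: U_inj; have /(congr1 val) := Am2_invK (Am2_Xm1 z).
Qed.

Lemma Am2_Xm1_linear : linear Am2_Xm1.
Proof. by move=> a x y; apply: val_inj; rewrite /= !linearP. Qed.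

Lemma Am2_inv_linear : linear Am2_inv.
Proof.
move=> a x y; apply: (can_inj Am2_Xm1K).
by rewrite Am2_invK Am2_Xm1_linear !Am2_invK.
Qed.

HB.instance Definition _ :=
  GRing.isLinear.Build K X0 Xm1 *:%R Am2_Xm1 Am2_Xm1_linear.
HB.instance Definition _ :=
  GRing.isLinear.Build K Xm1 X0 *:%R Am2_inv Am2_inv_linear.

(* X_{-1} carries the norm of A_{-2}^{-1} x in X_0, not the norm of uX_{-2}. *)
Definition Xm1_norm (x : Xm1) : K := `|Am2_inv x|.

Lemma Xm1_normD x y : Xm1_norm (x + y) <= Xm1_norm x + Xm1_norm y.
Proof. by rewrite /Xm1_norm linearD ler_normD. Qed.

Lemma Xm1_normZ (a : K) x : Xm1_norm (a *: x) = `|a| * Xm1_norm x.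
Proof. by rewrite /Xm1_norm linearZ normrZ. Qed.

Lemma Xm1_norm0_eq0 x : Xm1_norm x = 0 -> x = 0.
Proof.
by move=> /normr0_eq0 x0; apply: (can_inj Am2_invK); rewrite x0 linear0.
Qed.

HB.instance Definition _ :=
  Lmodule_isNormed.Build K Xm1 Xm1_normD Xm1_normZ Xm1_norm0_eq0.

Lemma Am2_inv_norm (x : Xm1) : `|Am2_inv x| = `|x|.
Proof. by []. Qed.

Lemma Xm1_complete (F : set_system Xm1) : ProperFilter F -> cauchy F -> cvg F.
Proof.
move=> FF /cauchy_ballP Fc.
have cG : cauchy (Am2_inv @ F).
  apply/cauchy_ballP => e e0; rewrite near_map2.
  have := Fc e e0; apply: filterS => -[x y] /=.
  by rewrite -!ball_normE /= -linearB Am2_inv_norm.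
have /cvg_ex[l /cvgrPdist_lt Gl] : cvg (Am2_inv @ F) by apply: cauchy_cvg.
apply/cvg_ex; exists (Am2_Xm1 l); apply/cvgrPdist_lt => e e0.
have := Gl e e0; apply: filterS => x.
by rewrite -[X in X - Am2_inv x]Am2_Xm1K -linearB Am2_inv_norm.
Qed.

HB.instance Definition _ := Uniform_isComplete.Build Xm1 Xm1_complete.

Lemma X0_sub_Xm1 (z : X0) : emb2 E (emb1 E z) \in in_Xm1.
Proof.
have : [set: uXm1 E] (emb1 E z) by [].
rewrite -(uAm1_onto E) => -[x Dx <-].
by apply/in_Xm1P; exists x; rewrite /= uAm2_extends.
Qed.

(* The embedding of X_0 into X_{-1}: both lie in uX_{-2}. *)
Definition X0_incl (z : X0) : Xm1 := InXm1 (X0_sub_Xm1 z).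

(* The restriction of uA_{-2} to X_0, as an operator on X_{-1}. *)
Definition Am1 : partial_op Xm1 :=
  PartialOp (range X0_incl)
    (fun x => Am2_Xm1 ('pinv_(fun=> 0) setT X0_incl x)).

End extrapolated_space.
End generators.

(* Main.v *)
(** The map [J := Am2_Xm1 E] is an isometric isomorphism of X_0 onto X_{-1}, and
    X_0 embeds into X_{-1} through [J \o A^-1]. Hence A_{-1} is [A] transported
    along [J], the extended semigroup is [J \o T t \o J^-1] (it restricts to [T]
    on X_0 because [T t] commutes with [A^-1]), and the norming subspace is [Y]
    pulled back along [J^-1]. *)

Require Import Defs.
From HB Require Import structures.
From mathcomp Require Import all_boot all_order all_algebra.
From mathcomp Require Import complex.
From mathcomp Require Import all_classical all_reals all_analysis.
Import Order.TTheory GRing.Theory Num.Theory.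
Import numFieldNormedType.Exports.
Local Open Scope classical_set_scope.
Local Open Scope ring_scope.

Set Implicit Arguments.
Unset Strict Implicit.

Section pinv.
Context {aT bT : Type} {D : set aT} {f : aT -> bT} {d : bT -> aT}.

Lemma set_bij_pinvE x y : set_bij D setT f -> D x -> f x = y -> 'pinv_d D f y = x.
Proof.
by move=> [_ finj _] Dx <-; rewrite pinvKV ?inE.
Qed.

(** Surjectivity onto [setT] provides a preimage of [y] in [D], so the partial inverse never falls
    back on its default [d]. *)
Lemma set_bij_pinvK y : set_bij D setT f -> D ('pinv_d D f y) /\ f ('pinv_d D f y) = y.
Proof.
move=> fbij; have [_ _ /(_ y I)[x Dx fx]] := fbij.
by rewrite (set_bij_pinvE fbij Dx fx).
Qed.

End pinv.

Section isometric_transport.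
Context {R : realType} {k : scalar_kind}.
Local Notation K := (scalars R k).

Lemma isometry_continuous (V W : normedModType K) (J : {linear V -> W}) :
  (forall x, `|J x| = `|x|) -> continuous J.
Proof.
move=> Jn x; apply/cvgrPdist_lt => e e0.
have /cvgrPdist_lt/(_ e e0) := @cvg_id _ (nbhs x).
by apply: filterS => z; rewrite -linearB Jn.
Qed.

Lemma opnorm_postisometry (V W W' : normedModType K) (J : W -> W') (f : V -> W) :
  (forall x, `|J x| = `|x|) -> opnorm (J \o f) = opnorm f.
Proof.
move=> Jn; congr sup; apply: eq_imagel => x _ /=.
by rewrite Jn.
Qed.

(** [J] and [Ji] map the closed unit balls into each other, so both suprema are taken over the same
    set of values. *)
Lemma opnorm_preisometry (V V' W : normedModType K) (J : V -> V') (Ji : V' -> V)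
    (f : V -> W) :
  cancel J Ji -> (forall x, `|Ji x| = `|x|) -> opnorm (f \o Ji) = opnorm f.
Proof.
move=> JK Jn; congr sup; apply/seteqP; split => _ [x /= x1 <-].
  by exists (Ji x) => //=; rewrite Jn.
by exists (J x) => /=; rewrite ?JK // -Jn JK.
Qed.

Variables (Z W : completeNormedModType K).
Variables (J : {linear Z -> W}) (Ji : {linear W -> Z}).
Hypotheses (JK : cancel J Ji) (JiK : cancel Ji J) (Jn : forall x, `|J x| = `|x|).
Variables (A : partial_op Z) (B : partial_op W).
(** The relation is required on [dom A] only: a [partial_op] has arbitrary values off its domain,
    where [B] and [J \o A \o Ji] may differ. *)
Hypotheses (domB : dom B = J @` dom A) (BE : forall x, dom A x -> B (J x) = J (A x)).

Let Jin x : `|Ji x| = `|x|. Proof. by rewrite -Jn JiK. Qed.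

Let Jc : continuous J. Proof. exact: isometry_continuous. Qed.

Let Jic : continuous Ji. Proof. exact: isometry_continuous. Qed.

Let conj_continuous (f : Z -> Z) : continuous f -> continuous (J \o f \o Ji).
Proof.
move=> fc x; apply: (@continuous_comp _ _ _ Ji (J \o f)); first exact: Jic.
by apply: continuous_comp; [exact: fc|exact: Jc].
Qed.

Let conj_linear (f : Z -> Z) : linear f -> linear (J \o f \o Ji).
Proof. by move=> fl a x y /=; rewrite linearP fl linearP. Qed.

(** Stated for any [f] and [g] intertwined by [J], so that it and [pinv_conj] cover both
    [lambda - A], for resolvents, and [A] itself, for [inverse_op]. *)
Lemma set_bij_conj (f : Z -> Z) (g : W -> W) :
  (forall x, dom A x -> g (J x) = J (f x)) ->
  set_bij (dom A) setT f -> set_bij (dom B) setT g.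
Proof.
move=> gE [_ finj fsurj]; split=> //.
  move=> u v; rewrite !inE domB => -[x Dx <-] [y Dy <-].
  rewrite !gE// => /(can_inj JK) fxy; congr (J _).
  by apply: finj; rewrite ?inE.
move=> w _; have [x Dx fx] := fsurj (Ji w) I.
exists (J x); first by rewrite domB; exists x.
by rewrite gE// fx JiK.
Qed.

(** [J] sends the preimage of [Ji w] under [f] to a preimage of [w] under [g], and [g] is injective
    on [dom B]. *)
Lemma pinv_conj (f : Z -> Z) (g : W -> W) :
  (forall x, dom A x -> g (J x) = J (f x)) ->
  set_bij (dom A) setT f ->
  'pinv_(fun=> 0) (dom B) g = J \o 'pinv_(fun=> 0) (dom A) f \o Ji.
Proof.
move=> gE fbij; apply/funext => w /=.
have [Dx fx] := set_bij_pinvK (d := fun=> 0) (Ji w) fbij.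
apply: set_bij_pinvE; first exact: set_bij_conj fbij.
- by rewrite domB; exists ('pinv_(fun=> 0) (dom A) f (Ji w)).
- by rewrite gE// fx JiK.
Qed.

Let subE (lambda : K) x : dom A x ->
  lambda *: J x - B (J x) = J (lambda *: x - A x).
Proof. by move=> Dx; rewrite BE// linearB linearZ. Qed.

Lemma resolvent_conj lambda : resolvent_set A lambda ->
  resolvent B lambda = J \o resolvent A lambda \o Ji.
Proof. by move=> [Abij _]; apply: pinv_conj Abij; exact: subE. Qed.

Lemma resolvent_set_conj lambda : resolvent_set A lambda -> resolvent_set B lambda.
Proof.
move=> rA; split; last by rewrite resolvent_conj//; apply: conj_continuous; case: rA.
by case: rA => Abij _; apply: set_bij_conj Abij; exact: subE.
Qed.

Lemma linear_op_conj : linear_op A -> linear_op B.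
Proof.
move=> [D0 Alin]; split; first by rewrite domB; exists 0; rewrite ?linear0.
move=> a x' y'; rewrite domB => -[x Dx <-] [y Dy <-].
have [Dxy Axy] := Alin a x y Dx Dy.
rewrite -linearP !BE// Axy; split; last exact: linearP.
by exists (a *: x + y).
Qed.

Lemma semigroup_conj (T : R -> Z -> Z) :
  semigroup T -> semigroup (fun t => J \o T t \o Ji).
Proof.
move=> [Tlc T0 TD]; split.
- by move=> t /Tlc[Tl Tc]; split; [apply: conj_linear|apply: conj_continuous].
- by apply/funext => w /=; rewrite T0 /= JiK.
- by move=> t s t0 s0; apply/funext => w /=; rewrite TD//= JK.
Qed.

Lemma dual_subspace_conj (Y : set (Z -> K)) :
  dual_subspace Y -> dual_subspace [set y \o Ji | y in Y].
Proof.
move=> [Ylc Y0 YD]; split.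
- move=> _ [y /Ylc[yl yc] <-]; split; first by move=> a u v /=; rewrite linearP yl.
  by move=> x; apply: continuous_comp; [exact: Jic|exact: yc].
- by exists (fun=> 0).
- move=> a _ _ [y1 Yy1 <-] [y2 Yy2 <-].
  by exists (fun z => a * y1 z + y2 z) => //; exact: YD.
Qed.

(** Pulling back along the isometry [Ji] preserves [opnorm], so the functionals of norm at most 1
    correspond, with equal values at [w] and [Ji w]. *)
Lemma norming_conj (Y : set (Z -> K)) :
  norming Y -> norming [set y \o Ji | y in Y].
Proof.
move=> Yn w; rewrite -Jin Yn; congr sup.
have opE y : opnorm (y \o Ji : W -> K^o) = opnorm (y : Z -> K^o).
  exact: opnorm_preisometry JK Jin.
apply/seteqP; split => [_ [y [Yy y1] <-]|_ [_ [[y Yy <-] y1] <-]].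
  by exists (y \o Ji) => //; split; [exists y|rewrite opE].
by exists y => //; split => //; rewrite -opE.
Qed.

(** This is the case [lambda = 0] of the resolvent condition, up to a sign. *)
Lemma generator_inverse_bij (Y : set (Z -> K)) (T : R -> Z -> Z) :
  generator Y T A -> set_bij (dom A) setT A.
Proof.
move=> hA; have [] := generator_resolvent_set hA (lexx 0).
have -> : of_real k (0 : R) = 0 by case: k.
move=> [_ Ainj Asurj] _; split => //.
  by move=> x y Dx Dy Axy; apply: Ainj => //; rewrite !scale0r Axy.
(* The bijection at hand is [- A], so a preimage of [- z] under it is a preimage of [z] under
   [A]. *)
move=> z _; have [x Dx] := Asurj (- z) I.
by rewrite scale0r sub0r => /oppr_inj <-; exists x.
Qed.

Lemma generator_conj (Y : set (Z -> K)) (T : R -> Z -> Z) :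
  generator Y T A ->
  generator [set y \o Ji | y in Y] (fun t => J \o T t \o Ji) B.
Proof.
move=> hA; split.
- exact/dual_subspace_conj/(generator_subspace hA).
- exact/norming_conj/(generator_norming hA).
- exact/semigroup_conj/(generator_semigroup hA).
- move=> t t0; rewrite (opnorm_preisometry (J \o T t) JK Jin).
  by rewrite opnorm_postisometry//; exact: generator_contraction hA _ t0.
- exact/linear_op_conj/(generator_linear hA).
- by move=> l /(generator_resolvent_set hA)/resolvent_set_conj.
- move=> l w _ l0 [y Yy <-].
  rewrite resolvent_conj; last exact: generator_resolvent_set hA _ l0.
  have := generator_laplace hA (Ji w) l0 Yy.
  (* Since [Ji] cancels [J], the integrand and the integral are those of [A] at the point [Ji w];
     nothing has to be integrated anew. *)
  congr (has_integral _ _); last by rewrite /= JK.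
  by apply/funext => s; rewrite /= JK.
- move=> t t0; have Abij := generator_inverse_bij hA.
  have -> : inverse_op B = J \o inverse_op A \o Ji := pinv_conj BE Abij.
  apply/funext => w /=; rewrite !JK; congr (J _).
  by have /(congr1 (fun f => f (Ji w))) := generator_comm hA t0.
Qed.

End isometric_transport.

(** Write [z = A x] with [x] in [dom A]: then [emb1 z] is [uAm1 x], and [uAm2] extends [uAm1], so
    [emb2 (emb1 z)] is [uAm2 (emb1 x)]. *)
Lemma X0_incl_inverse_op (R : realType) (k : scalar_kind)
    (X0 : completeNormedModType (scalars R k)) (A : partial_op X0)
    (E : extrapolation A) (z : X0) :
  set_bij (dom A) setT A -> X0_incl E z = Am2_Xm1 E (inverse_op A z).
Proof.
move=> Abij; have [Dx Ax] := set_bij_pinvK (d := fun=> 0) z Abij.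
apply: val_inj => /=; rewrite uAm2_extends; last exact: subset_closure.
by rewrite uAm1_extends// Ax.
Qed.

Unset Implicit Arguments.
Set Strict Implicit.

Theorem proposition3p8 (R : realType) (k : scalar_kind)
    (X0 : completeNormedModType (scalars R k))
    (Y : set (X0 -> scalars R k)) (T : R -> X0 -> X0) (A : partial_op X0)
    (hA : generator Y T A) (hT : negative_growth_bound T)
    (E : extrapolation A) :
  exists Tm1 : R -> Xm1 E -> Xm1 E,
    [/\ semigroup Tm1,
        forall (t : R) (x : X0), 0 <= t -> Tm1 t (X0_incl E x) = X0_incl E (T t x) &
        exists Ym1 : set (Xm1 E -> scalars R k), generator Ym1 Tm1 (Am1 E)].
Proof.
have Abij := generator_inverse_bij hA.
have inclE z := X0_incl_inverse_op E z Abij.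
have AK x : dom A x -> inverse_op A (A x) = x by move=> Dx; exact: set_bij_pinvE.
have inclA x : dom A x -> X0_incl E (A x) = Am2_Xm1 E x by move=> Dx; rewrite inclE AK.
have Jn x : `|Am2_Xm1 E x| = `|x| by rewrite -Am2_inv_norm Am2_Xm1K.
(* By [inclE], the copy of X_0 in X_{-1} is the image under [Am2_Xm1 E] of the range of A^-1, which
   is [dom A]. *)
have domB : dom (Am1 E) = Am2_Xm1 E @` dom A.
  apply/seteqP; split => [_ [z _ <-]|_ [x Dx <-]].
    by exists (inverse_op A z); [case: (set_bij_pinvK (d := fun=> 0) z Abij)|rewrite inclE].
  by exists (A x) => //; exact: inclA.
(* [Am1] is built from a partial inverse of [X0_incl E], which recovers the embedded point once the
   embedding is injective. *)
have incl_inj : injective (X0_incl E).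
  move=> z1 z2; rewrite !inclE => /(can_inj (@Am2_Xm1K _ _ _ _ E)) z12.
  have [_ <-] := set_bij_pinvK (d := fun=> 0) z1 Abij.
  by rewrite -/(inverse_op A z1) z12; case: (set_bij_pinvK (d := fun=> 0) z2 Abij).
have BE x : dom A x -> Am1 E (Am2_Xm1 E x) = Am2_Xm1 E (A x).
  (* Seen in X_{-1}, [Am2_Xm1 E x] is the embedded vector [A x], to which [Am1 E] applies
     [Am2_Xm1 E]. *)
  move=> Dx; rewrite -inclA//=; congr Am2_Xm1.
  by rewrite pinvKV ?inE// => z1 z2 _ _; exact: incl_inj.
exists (fun t => Am2_Xm1 E \o T t \o @Am2_inv _ _ _ _ E); split.
- apply: semigroup_conj (generator_semigroup hA) => //.
  + exact: Am2_Xm1K.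
  + exact: Am2_invK.
- move=> t x t0; rewrite !inclE /= Am2_Xm1K.
  by have /(congr1 (fun f => f x)) /= -> := generator_comm hA t0.
- exists [set y \o @Am2_inv _ _ _ _ E | y in Y].
  apply: generator_conj hA => //.
  + exact: Am2_Xm1K.
  + exact: Am2_invK.
Qed.
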